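(* Let $\mathscr{V}=(\mathcal{V}_t,\alpha_V^{s\to t},\beta_V^{t\to s})$ and $\mathscr{W}=(\mathcal{W}_t,\alpha_W^{s\to t},\beta_W^{t\to s})$ be vineyard modules over the same vineyard with vines $\{\gamma_i\}$. Suppose that $(\{\gamma_i\},\{M(\alpha)^{s\to t}\},\{M(\beta)^{t\to s}\})$ is a vine and matrix representation of both $\mathscr{V}$ and $\mathscr{W}$. Then $\mathscr{V}$ and $\mathscr{W}$ are isomorphic as vineyard modules.
   Context: Fix a field. A persistence module $\mathcal{X}$ is a family of vector spaces $(X_h)_{h\in\mathbb{R}}$ with transition maps $\phi_g^h:X_g\to X_h$ for $g\le h$, $\phi_h^h=\mathrm{id}$, $\phi_g^h\phi_f^g=\phi_f^h$. All persistence modules are assumed isomorphic to $\bigoplus_{i=1}^N\mathcal{I}[b_i,d_i)$ (interval modules) with $N$ finite, $b_i$ finite and the intervals pairwise distinct. An $\epsilon$-morphism $\alpha:\mathcal{X}\to\mathcal{Y}$ is a family of linear maps $\alpha_h:X_h\to Y_{h+\epsilon}$ commuting with transition maps; a morphism is a $0$-morphism; an $\epsilon$-interleaving is a pair of $\epsilon$-morphisms $\alpha:\mathcal{X}\to\mathcal{Y}$, $\beta:\mathcal{Y}\to\mathcal{X}$ whose composites (both orders) are the transition maps shifting height by $2\epsilon$. A (1-Lipschitz) vineyard module over $[s_0,s_1]$ is a family of persistence modules $\{\mathcal{V}_t\}_{t\in[s_0,s_1]}$ with, for each $s<t$, a $|s-t|$-interleaving $\alpha^{s\to t}:\mathcal{V}_s\to\mathcal{V}_t$,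 $\beta^{t\to s}:\mathcal{V}_t\to\mathcal{V}_s$, such that all interleaving maps commute with each other and with the transition maps. A morphism of vineyard modules is a family of morphisms of persistence modules, one for each time, commuting with all interleaving and transition maps; an isomorphism is an invertible morphism. The underlying vineyard is the path of persistence diagrams of $\mathcal{V}_t$ (continuous for the bottleneck distance). A vine is such a path with at most one off-diagonal point at each time, whose support (the set of times with an off-diagonal point) is a nonempty interval. Since no diagram has points of multiplicity $\ge2$, the vineyard is uniquely a union of vines; it is assumed that there are finitely many vines $\gamma_1,\dots,\gamma_N$, finitely many times at which births and deaths are not all distinct, and that at each such time at most one pair of birth/death values coincides. Write $\gamma_i(t)=(\mathbf{b}(\gamma_i(t)),\mathbf{d}(\gamma_i(t)))$ for $t\in\operatorname{supp}(\gamma_i)$. For $x\in X_h$, $\mathbf{b}(x)=h$ if $x$ is not in the image of $\phi_g^h$ for any $g<h$; then $\mathbf{d}(x)=\inf\{g>\mathbf{b}(x):\phi_{\mathbf{b}(x)}^g(x)=0\}$. A basis of $\mathcal{X}\cong\bigoplus_i\mathcal{I}[b_i,d_i)$ is a set $\{x_i\}$ with $x_i\in X_{b_i}$, $\mathbf{b}(x_i)=b_i$, $\mathbf{d}(x_i)=d_i$, such that for each $h$ the set $\{\phi_{b_i}^h(x_i):b_i\le h<d_i\}$ is a basis of $X_h$. An extended basis is a basis together with an indexed set of zero elements. For an $\epsilon$-morphism $\alpha:\mathcal{X}\to\mathcal{Y}$ and bases $B_X=\{x_i\}$, $B_Y=\{y_j\}$, $\mathrm{Mat}_{B_X}^{B_Y}(\alpha)$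 is defined by $\alpha(x_i)=\sum_j\mathrm{Mat}_{B_X}^{B_Y}(\alpha)(j,i)\,\psi_{\mathbf{b}(y_j)}^{\mathbf{b}(x_i)+\epsilon}(y_j)$, summing over $j$ with $\mathbf{b}(y_j)\le\mathbf{b}(x_i)+\epsilon<\mathbf{d}(y_j)$ ($\psi$ the transition maps of $\mathcal{Y}$), all other entries being $0$; rows and columns of zero elements of extended bases are zero. A vine and matrix representation of $\mathscr{V}$ consists of its set of vines $\{\gamma_1,\dots,\gamma_N\}$ and families of matrices $\{M(\alpha)^{s\to t}\mid s_0\le s<t\le s_1\}$ and $\{M(\beta)^{t\to s}\mid s_0\le s<t\le s_1\}$ such that there exists a family of extended bases $B_t=\{x_1^t,\dots,x_N^t\}$ of $\mathcal{V}_t$ respecting the order of the vines ($x_i^t$ has birth $\mathbf{b}(\gamma_i(t))$ and death $\mathbf{d}(\gamma_i(t))$ if $t\in\operatorname{supp}(\gamma_i)$, and $x_i^t=0$ otherwise) with $M(\alpha)^{s\to t}=\mathrm{Mat}_{B_s}^{B_t}(\alpha^{s\to t})$ and $M(\beta)^{t\to s}=\mathrm{Mat}_{B_t}^{B_s}(\beta^{t\to s})$ for all $s<t$. *)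

(* Defs.v *)
From HB Require Import structures.
From mathcomp Require Export all_boot all_order all_algebra.
From mathcomp Require Export all_classical all_reals ereal num_normedtype.

Set Implicit Arguments.
Unset Strict Implicit.
Unset Printing Implicit Defensive.
Import Order.TTheory GRing.Theory Num.Theory.
Local Open Scope classical_set_scope.
Local Open Scope ring_scope.

Record persmod (R : realType) (K : fieldType) := PersMod {
  space :> R -> lmodType K;
  tmap : forall g h : R, g <= h -> {linear space g -> space h};
  tmap_id : forall h (hh : h <= h) x, tmap hh x = x;
  tmap_comp : forall f g h (fg : f <= g) (gh : g <= h) (fh : f <= h) x,
    tmap gh (tmap fg x) = tmap fh x
}.
Arguments tmap {R K} p {g h}.

(* The component at height h of an e-morphism lands in Y_{h+e}. It is indexed by
   a height k together with a proof of k = h + e: proofs of an equation in R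
   being unique, this is the same data as a family indexed by h, and it avoids
   transports along identities such as h + (a + b) = (h + a) + b. *)
Record emorph (R : realType) (K : fieldType) (X Y : persmod R K) (e : R) :=
  EMorph {
  em :> forall h k : R, k = h + e -> {linear X h -> Y k};
  em_tmap : forall g h k l (gh : g <= h) (kl : k <= l)
      (gk : k = g + e) (hl : l = h + e) x,
    tmap Y kl (em gk x) = em hl (tmap X gh x)
}.
Arguments em {R K X Y e} e0 {h k} : rename.

Definition morph (R : realType) (K : fieldType) (X Y : persmod R K) :=
  emorph X Y 0.

Definition morph_at (R : realType) (K : fieldType) (X Y : persmod R K)
    (f : morph X Y) (h : R) : {linear X h -> Y h} := em f (esym (addr0 h)).

Definition persmod_iso (R : realType) (K : fieldType) (X Y : persmod R K) :=
  exists (f : morph X Y) (g : morph Y X), forall h,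
    cancel (morph_at f h) (morph_at g h) /\ cancel (morph_at g h) (morph_at f h).

Definition interleaving (R : realType) (K : fieldType) (X Y : persmod R K)
    (e : R) (a : emorph X Y e) (b : emorph Y X e) :=
  (forall h k l (hk : k = h + e) (kl : l = k + e) (hl : h <= l) x,
     em b kl (em a hk x) = tmap X hl x) /\
  (forall h k l (hk : k = h + e) (kl : l = k + e) (hl : h <= l) y,
     em a kl (em b hk y) = tmap Y hl y).

(* An interval [b, d) with finite b; d = +oo is allowed. *)
Notation bar R := (R * \bar R)%type.

Definition in_bar (R : realType) (p : bar R) (h : R) : bool :=
  (p.1 <= h) && (h%:E < p.2)%E.

Section IntervalModule.
Variables (R : realType) (K : fieldType) (p : bar R).

(* K for h in [b, d), and the zero space otherwise. *)
Definition ispace (h : R) : lmodType K := 'rV[K]_(in_bar p h).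

(* The identity of K if both dimensions are 1, and 0 otherwise. *)
Definition imap (g h : R) (gh : g <= h) : {linear ispace g -> ispace h} :=
  mulmxr (const_mx 1 : 'M[K]_(in_bar p g, in_bar p h)).

Lemma imap_id h (hh : h <= h) x : imap hh x = x.
Proof.
rewrite /imap /=; move: x; rewrite /ispace; case: (in_bar p h) => x.
  have -> : const_mx 1 = 1%:M :> 'M[K]_1.
    by apply/matrixP => i j; rewrite !mxE !ord1.
  by rewrite mulmx1.
by apply/rowP => -[].
Qed.

Lemma imap_comp f g h (fg : f <= g) (gh : g <= h) (fh : f <= h) x :
  imap gh (imap fg x) = imap fh x.
Proof.
rewrite /imap /= -mulmxA; congr (_ *m _).
have : in_bar p f -> in_bar p h -> in_bar p g.
  move=> /andP[bf _] /andP[_ hd]; apply/andP; split; first exact: le_trans fg.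
  by apply: le_lt_trans hd; rewrite lee_fin.
case: (in_bar p f); case: (in_bar p g); case: (in_bar p h) => // H;
  try by apply/matrixP => -[] // ? ? [].
- by apply/matrixP => i j; rewrite !mxE big_ord1 !mxE mulr1.
- by have := H isT isT.
Qed.

Definition interval_module : persmod R K := PersMod imap_id imap_comp.
End IntervalModule.

Section DirectSum.
Variables (R : realType) (K : fieldType).

Definition zero_module : persmod R K :=
  @PersMod R K (fun=> 'rV[K]_0) (fun _ _ _ => idfun)
    (fun _ _ _ => erefl) (fun _ _ _ _ _ _ _ => erefl).

Variables X Y : persmod R K.

Definition pmap g h (gh : g <= h) (z : X g * Y g) : X h * Y h :=
  (tmap X gh z.1, tmap Y gh z.2).

Lemma pmap_linear g h (gh : g <= h) : linear (pmap gh).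
Proof. by move=> a u v; rewrite /pmap /= !linearP. Qed.

HB.instance Definition _ g h (gh : g <= h) :=
  GRing.isLinear.Build K (X g * Y g)%type (X h * Y h)%type _ (pmap gh)
    (pmap_linear gh).

Lemma pmap_id h (hh : h <= h) z : pmap hh z = z.
Proof. by case: z => x y; rewrite /pmap !tmap_id. Qed.

Lemma pmap_comp f g h (fg : f <= g) (gh : g <= h) (fh : f <= h) z :
  pmap gh (pmap fg z) = pmap fh z.
Proof. by case: z => x y; rewrite /pmap !(tmap_comp _ _ fh). Qed.

Definition dsum_module : persmod R K :=
  @PersMod R K (fun h => (X h * Y h)%type) (fun g h gh => pmap gh)
    pmap_id pmap_comp.
End DirectSum.

Definition interval_sum (R : realType) (K : fieldType) (s : seq (bar R)) :
    persmod R K :=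
  foldr (fun p => dsum_module (interval_module K p)) (zero_module R K) s.

(* X is isomorphic to a finite direct sum of interval modules of pairwise
   distinct nonempty intervals, and D is the set of these intervals, i.e. the
   off-diagonal points of the persistence diagram (all of multiplicity 1). *)
Definition is_diagram (R : realType) (K : fieldType) (X : persmod R K)
    (D : set (bar R)) :=
  exists s : seq (bar R),
    [/\ uniq s, {in s, forall p, (p.1%:E < p.2)%E}, D = [set` s] &
        persmod_iso X (interval_sum K s)].

(* The two inequalities on deaths say |p.2 - q.2| <= e, with the convention that
   +oo is at distance 0 from +oo and at infinite distance from finite deaths. *)
Definition close_bars (R : realType) (e : R) (p q : bar R) :=
  [/\ `|p.1 - q.1| <= e, (p.2 <= q.2 + e%:E)%E & (q.2 <= p.2 + e%:E)%E].

(* The l^oo distance from p to the diagonal is (p.2 - p.1) / 2. *)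
Definition near_diagonal (R : realType) (e : R) (p : bar R) :=
  (p.2 <= (p.1 + e *+ 2)%:E)%E.

(* M is the graph of a partial bijection between the off-diagonal points;
   unmatched points are matched to the diagonal. *)
Definition bottleneck_matching (R : realType) (e : R) (D E : set (bar R))
    (M : bar R -> bar R -> Prop) :=
  [/\ forall p q, M p q -> [/\ D p, E q & close_bars e p q],
      forall p q q', M p q -> M p q' -> q = q',
      forall p p' q, M p q -> M p' q -> p = p',
      forall p, D p -> (exists q, M p q) \/ near_diagonal e p &
      forall q, E q -> (exists p, M p q) \/ near_diagonal e q].

Definition bottleneck (R : realType) (D E : set (bar R)) : \bar R :=
  ereal_inf [set e%:E | e in
    [set e : R | 0 <= e /\ exists M, bottleneck_matching e D E M]].

Definition time (R : realType) (s0 s1 : R) := {t : R | s0 <= t <= s1}.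
Definition tlt (R : realType) (s0 s1 : R) (s t : time s0 s1) : bool :=
  sval s < sval t.
Definition tdist (R : realType) (s0 s1 : R) (s t : time s0 s1) : R :=
  `|sval s - sval t|.

Definition diagram_of (R : realType) (o : option (bar R)) : set (bar R) :=
  [set p | o = Some p].

Definition support (R : realType) (s0 s1 : R)
    (c : time s0 s1 -> option (bar R)) : set R :=
  [set sval t | t in [set t | c t <> None]].

Record is_vine (R : realType) (s0 s1 : R)
    (c : time s0 s1 -> option (bar R)) : Prop := IsVine {
  vine_off_diagonal : forall t p, c t = Some p -> (p.1%:E < p.2)%E;
  vine_support_neq0 : support c !=set0;
  vine_support_itv : is_interval (support c);
  vine_continuous : forall (t : time s0 s1) (e : R), 0 < e ->
    exists2 d : R, 0 < d & forall u : time s0 s1, tdist t u < d ->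
      (bottleneck (diagram_of (c t)) (diagram_of (c u)) < e%:E)%E
}.

(* The birth (k = false) or the death (k = true) of a bar. Infinite deaths are
   left out, so that two bars dying at +oo do not count as coinciding below. *)
Definition endpoint (R : realType) (o : option (bar R)) (k : bool) : option R :=
  match o with
  | Some (b, d) => if k then (if d is r%:E then Some r else None) else Some b
  | None => None
  end.

(* The distinct labels u and v (an index of a vine, and birth or death) have
   the same value at time t. *)
Definition coincide (R : realType) (s0 s1 : R) (N : nat)
    (gam : 'I_N -> time s0 s1 -> option (bar R)) (t : time s0 s1)
    (u v : 'I_N * bool) :=
  u <> v /\ exists r : R, endpoint (gam u.1 t) u.2 = Some r /\
                          endpoint (gam v.1 t) v.2 = Some r.

(* The vines of a vineyard satisfying the standing assumptions: no diagram has a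
   point of multiplicity >= 2, and coincidences of births and deaths occur at
   finitely many times, for a single (unordered) pair of labels each time. *)
Record is_vineyard (R : realType) (s0 s1 : R) (N : nat)
    (gam : 'I_N -> time s0 s1 -> option (bar R)) : Prop := IsVineyard {
  vineyard_vines : forall i, is_vine (gam i);
  vineyard_simple : forall t p i j,
    gam i t = Some p -> gam j t = Some p -> i = j;
  vineyard_finite_coincide :
    finite_set [set t | exists u v, coincide gam t u v];
  vineyard_single_coincide : forall t u v u' v',
    coincide gam t u v -> coincide gam t u' v' ->
    (u = u' /\ v = v') \/ (u = v' /\ v = u')
}.

(* The interleaving identities, [vy_aa] and [vy_bb] imply all the other
   commutation relations between the interleaving maps, in particular
   b^{u->t} a^{s->u} = a^{s->t} and a^{s->u} b^{t->s} = a^{t->u} up to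
   transition maps for s < t < u: see [vy_ab] and [vy_ba]. *)
Record vymod (R : realType) (K : fieldType) (s0 s1 : R) := VyMod {
  vy :> time s0 s1 -> persmod R K;
  vy_a : forall s t : time s0 s1, tlt s t ->
    emorph (vy s) (vy t) (tdist s t);
  vy_b : forall s t : time s0 s1, tlt s t ->
    emorph (vy t) (vy s) (tdist s t);
  vy_interleaving : forall (s t : time s0 s1) (st : tlt s t),
    interleaving (vy_a st) (vy_b st);
  vy_aa : forall (s t u : time s0 s1) (st : tlt s t) (tu : tlt t u)
      (su : tlt s u) h k l (hk : k = h + tdist s t)
      (kl : l = k + tdist t u) (hl : l = h + tdist s u) x,
    em (vy_a tu) kl (em (vy_a st) hk x) = em (vy_a su) hl x;
  vy_bb : forall (s t u : time s0 s1) (st : tlt s t) (tu : tlt t u)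
      (su : tlt s u) h k l (hk : k = h + tdist t u)
      (kl : l = k + tdist s t) (hl : l = h + tdist s u) x,
    em (vy_b st) kl (em (vy_b tu) hk x) = em (vy_b su) hl x
}.
Arguments vy_interleaving {R K s0 s1} v {s t}.
Arguments vy_a {R K s0 s1} v {s t}.
Arguments vy_b {R K s0 s1} v {s t}.

Lemma tdistD (R : realType) (s0 s1 : R) (s t u : time s0 s1) :
  tlt s t -> tlt t u -> tdist s u = tdist s t + tdist t u.
Proof.
move=> st tu; rewrite /tdist !ltr0_norm ?subr_lt0 ?(lt_trans st tu)//.
by rewrite -opprD addrA subrK.
Qed.

Lemma vy_ab (R : realType) (K : fieldType) (s0 s1 : R) (V : vymod K s0 s1)
    (s t u : time s0 s1) (st : tlt s t) (tu : tlt t u) (su : tlt s u) h k l m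
    (hk : k = h + tdist s u) (kl : l = k + tdist t u) (hm : m = h + tdist s t)
    (ml : m <= l) x :
  em (vy_b V tu) kl (em (vy_a V su) hk x) = tmap (V t) ml (em (vy_a V st) hm x).
Proof.
have mk : k = m + tdist t u by rewrite hk hm (tdistD st tu) addrA.
by rewrite -(vy_aa st tu su hm mk) (proj1 (vy_interleaving V tu) _ _ _ _ _ ml).
Qed.

Lemma vy_ba (R : realType) (K : fieldType) (s0 s1 : R) (V : vymod K s0 s1)
    (s t u : time s0 s1) (st : tlt s t) (tu : tlt t u) (su : tlt s u) h k l m
    (hk : k = h + tdist s t) (kl : l = k + tdist s u) (hm : m = h + tdist t u)
    (ml : m <= l) x :
  em (vy_a V su) kl (em (vy_b V st) hk x) = tmap (V u) ml (em (vy_a V tu) hm x).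
Proof.
have kn : k + tdist s t = k + tdist s t by [].
have nl : l = k + tdist s t + tdist t u by rewrite kl (tdistD st tu) addrA.
have hn : h <= k + tdist s t.
  by rewrite hk -addrA lerDl addr_ge0// normr_ge0.
rewrite -(vy_aa st tu su kn nl) (proj2 (vy_interleaving V st) _ _ _ _ _ hn).
by rewrite (em_tmap _ hn ml hm nl).
Qed.

Record vymorph (R : realType) (K : fieldType) (s0 s1 : R)
    (V W : vymod K s0 s1) := VyMorph {
  vyf :> forall t, morph (V t) (W t);
  vyf_a : forall (s t : time s0 s1) (st : tlt s t) h k
      (hk : k = h + tdist s t) x,
    morph_at (vyf t) k (em (vy_a V st) hk x) =
    em (vy_a W st) hk (morph_at (vyf s) h x);
  vyf_b : forall (s t : time s0 s1) (st : tlt s t) h k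
      (hk : k = h + tdist s t) x,
    morph_at (vyf s) k (em (vy_b V st) hk x) =
    em (vy_b W st) hk (morph_at (vyf t) h x)
}.

Definition vymod_iso (R : realType) (K : fieldType) (s0 s1 : R)
    (V W : vymod K s0 s1) :=
  exists (F : vymorph V W) (G : vymorph W V), forall t h,
    cancel (morph_at (F t) h) (morph_at (G t) h) /\
    cancel (morph_at (G t) h) (morph_at (F t) h).

(* The underlying vineyard of V is the union of the vines [gam]. *)
Definition underlying_vineyard (R : realType) (K : fieldType) (s0 s1 : R)
    (V : vymod K s0 s1) (N : nat)
    (gam : 'I_N -> time s0 s1 -> option (bar R)) :=
  forall t, is_diagram (V t) [set p | exists i, gam i t = Some p].

Definition is_born (R : realType) (K : fieldType) (X : persmod R K) (h : R)
    (x : X h) :=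
  forall g (gh : g < h) (y : X g), tmap X (ltW gh) y <> x.

(* For an element born at height h; +oo if x never dies. *)
Definition death (R : realType) (K : fieldType) (X : persmod R K) (h : R)
    (x : X h) : \bar R :=
  ereal_inf [set g%:E | g in
    [set g : R | exists hg : h < g, tmap X (ltW hg) x = 0]].

(* [Some (existT _ b x)] is an element x of X_b, [None] a zero element of an
   extended basis. *)
Definition xelt (R : realType) (K : fieldType) (X : persmod R K) :=
  option {b : R & X b}.

Section ExtendedBasis.
Variables (R : realType) (K : fieldType) (X : persmod R K).

Definition alive (o : xelt X) (h : R) : bool :=
  if o is Some (existT b x) then (b <= h) && (h%:E < death x)%E else false.

(* The image of an element in X_h; the value is irrelevant (and 0) for zero
   elements and for h below the height of the element. *)
Definition push (o : xelt X) (h : R) : X h :=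
  if o is Some (existT b x) then
    (if @idP (b <= h) is ReflectT bh then tmap X bh x else 0)
  else 0.

(* The nonzero elements form a basis realizing the bars D i <> None, and x i is
   a zero element when D i = None. *)
Definition is_xbasis (N : nat) (D : 'I_N -> option (bar R))
    (x : 'I_N -> xelt X) :=
  [/\ forall i, match D i, x i with
                | Some p, Some (existT b v) =>
                    [/\ b = p.1, is_born v & death v = p.2]
                | None, None => True
                | _, _ => False
                end,
      forall h (c : 'I_N -> K),
        \sum_(i | alive (x i) h) c i *: push (x i) h = 0 ->
        forall i, alive (x i) h -> c i = 0 &
      forall h (v : X h), exists c : 'I_N -> K,
        v = \sum_(i | alive (x i) h) c i *: push (x i) h].
End ExtendedBasis.

(* M is the matrix of a with respect to the extended bases x and y; zero
   elements are never alive, so that their rows vanish too. *)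
Definition is_matrix_of (R : realType) (K : fieldType) (X Y : persmod R K)
    (e : R) (a : emorph X Y e) (m n : nat) (x : 'I_m -> xelt X)
    (y : 'I_n -> xelt Y) (M : 'M[K]_(n, m)) :=
  forall i, match x i with
  | Some (existT b v) =>
      em a erefl v =
        \sum_(j | alive (y j) (b + e)) M j i *: push (y j) (b + e) /\
      (forall j, ~~ alive (y j) (b + e) -> M j i = 0)
  | None => forall j, M j i = 0
  end.

Definition vine_matrix_repr (R : realType) (K : fieldType) (s0 s1 : R)
    (V : vymod K s0 s1) (N : nat)
    (gam : 'I_N -> time s0 s1 -> option (bar R))
    (Ma Mb : forall s t : time s0 s1, tlt s t -> 'M[K]_N) :=
  exists2 B : forall t, 'I_N -> xelt (V t),
    forall t, is_xbasis (gam^~ t) (B t) &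
    forall (s t : time s0 s1) (st : tlt s t),
      is_matrix_of (vy_a V st) (B s) (B t) (Ma s t st) /\
      is_matrix_of (vy_b V st) (B t) (B s) (Mb s t st).

(* Main.v *)
Require Import Defs.
From HB Require Import structures.
Import Order.TTheory GRing.Theory Num.Theory.
Local Open Scope ring_scope.

Set Implicit Arguments.
Unset Strict Implicit.
Unset Printing Implicit Defensive.

(** Sending the basis elements of [V t] to those of [W t] with the same index
    defines a linear isomorphism at each height. Since the image of a basis
    element past its death is zero, this isomorphism matches the images of the
    basis elements at every height, and commutation with the structure maps can
    be checked on these images, where it holds because the structure maps of
    both sides have the same matrices. *)

Section LinearExtension.
Variables (K : fieldType) (n : nat) (P : pred 'I_n).

Lemma eq_linear_span (U U' : lmodType K) (u : 'I_n -> U)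
    (f g : {linear U -> U'}) :
  (forall v, exists c : 'I_n -> K, v = \sum_(i | P i) c i *: u i) ->
  (forall i, P i -> f (u i) = g (u i)) -> f =1 g.
Proof.
move=> gen_u fg v; have [c ->] := gen_u v.
by rewrite !linear_sum; apply: eq_bigr => i Pi; rewrite !linearZ /= fg.
Qed.

Lemma linear_extension (U U' : lmodType K) (u : 'I_n -> U) (u' : 'I_n -> U') :
  (forall c : 'I_n -> K, \sum_(i | P i) c i *: u i = 0 ->
     forall i, P i -> c i = 0) ->
  (forall v, exists c : 'I_n -> K, v = \sum_(i | P i) c i *: u i) ->
  exists f : {linear U -> U'}, forall i, P i -> f (u i) = u' i.
Proof.
move=> free_u gen_u; pose c v := sval (cid (gen_u v)).
have cE v : v = \sum_(i | P i) c v i *: u i by rewrite /c; case: cid.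
(* The chosen coordinates are arbitrary outside [P]; freeness determines them on [P], and this
   uniqueness yields both linearity and the values at [u i]. *)
have c_uniq v d : v = \sum_(i | P i) d i *: u i ->
    forall i, P i -> c v i = d i.
  move=> vd i Pi; apply/eqP; rewrite -subr_eq0; apply/eqP.
  apply: (free_u (fun i => c v i - d i)) => //.
  by under eq_bigr do rewrite scalerBl; rewrite sumrB -cE -vd subrr.
pose f v := \sum_(i | P i) c v i *: u' i.
have f_lin : linear f.
  move=> a v w; rewrite /f scaler_sumr -big_split /=; apply: eq_bigr => i Pi.
  rewrite (c_uniq _ (fun i => a * c v i + c w i)) ?scalerDl ?scalerA//.
  rewrite [v in LHS]cE [w in LHS]cE scaler_sumr -big_split /=.
  by apply: eq_bigr => j _; rewrite scalerDl scalerA.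
pose L := GRing.isLinear.Build K U U' _ f f_lin.
pose F : {linear U -> U'} := HB.pack f L.
exists F => i Pi; rewrite /F /= /f (bigD1 i)//= big1 => [|j /andP[Pj ji]].
  rewrite (c_uniq _ (fun j => (j == i)%:R)) ?eqxx ?scale1r ?addr0//.
  rewrite (bigD1 i)//= eqxx scale1r big1 ?addr0// => j /andP[_ /negPf->].
  by rewrite scale0r.
rewrite (c_uniq _ (fun j => (j == i)%:R)) ?(negPf ji) ?scale0r//.
rewrite (bigD1 i)//= eqxx scale1r big1 ?addr0// => k /andP[_ /negPf->].
by rewrite scale0r.
Qed.

End LinearExtension.

Section ExtendedBasisTheory.
Variables (R : realType) (K : fieldType).
Implicit Type X : persmod R K.

Lemma push_Some X (b h : R) (v : X b) (bh : b <= h) :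
  push (Some (existT (fun b => X b) b v)) h = tmap X bh v.
Proof.
rewrite /push; case: {-}_ / idP => [bh'|/(_ bh)//].
by congr (tmap X _ v); exact: bool_irrelevance.
Qed.

(** Liveness ensures that [g] is not below the birth, where [push] takes its default value 0. *)
Lemma tmap_push X (o : xelt X) (g h : R) (gh : g <= h) :
  alive o g -> tmap X gh (push o g) = push o h.
Proof.
case: o => [[b v]|//] /andP[bg _].
rewrite (push_Some _ bg) (push_Some _ (le_trans bg gh)).
exact: tmap_comp.
Qed.

(** By strictness, some height below [g] already kills [v], whether or not the infimum is
    attained. *)
Lemma push_after_death X (b g : R) (v : X b) :
  b < g -> (death v < g%:E)%E -> push (Some (existT (fun b => X b) b v)) g = 0.
Proof.
move=> bg /ereal_inf_lt[_ [k [bk vk0] <-]]; rewrite lte_fin => kg.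
by rewrite (push_Some _ (ltW bg)) -(tmap_comp (ltW bk) (ltW kg)) vk0 linear0.
Qed.

(** Bars are open on the right, so each live element survives a little longer; finiteness of the
    family gives a common delay. *)
Lemma alive_right X n (x : 'I_n -> xelt X) (h : R) :
  exists2 g, h < g & forall i, alive (x i) h -> alive (x i) g.
Proof.
have step i : exists2 e : R, 0 < e &
    forall g, h <= g -> g < h + e -> alive (x i) h -> alive (x i) g.
  case: (x i) => [[b v]|]; last by exists 1.
  case: (ltP h%:E (death v)) => [hv|vh]; last first.
    by exists 1 => // g hg _ /=; rewrite ltNge vh andbF.
  case dv: (death v) hv => [d| |] // hd.
  - exists (d - h); first by rewrite subr_gt0 -lte_fin.
    move=> g hg; rewrite addrC subrK => gd /andP[bh _] /=.
    by rewrite (le_trans bh hg) dv lte_fin.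
  - exists 1 => // g hg _ /andP[bh _] /=.
    by rewrite (le_trans bh hg) dv ltry.
pose e i := s2val (cid2 (step i)).
have e_gt0 i : 0 < e i by rewrite /e; case: cid2.
have eP i : forall g, h <= g -> g < h + e i -> alive (x i) h -> alive (x i) g.
  by rewrite /e; case: cid2.
(* The default 1 keeps [m] positive for an empty family; [m / 2] is used below because the bound in
   [eP] is strict. *)
pose m := \big[Order.min/1]_i e i.
have m_gt0 : 0 < m by apply: (big_ind (fun r => 0 < r)) => // a b a0 b0; rewrite lt_min a0.
have hm : h < h + m / 2 by rewrite ltrDl divr_gt0.
exists (h + m / 2) => // i; apply: eP; first exact: ltW.
rewrite ltrD2l (@lt_le_trans _ _ m)//; last exact: bigmin_le.
by rewrite ltr_pdivrMr// ltr_pMr// ltr1n.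
Qed.

(* [death] is an infimum that is attained only because [X] has a finite basis:
   the coordinates at the time of death of the image of the dying element are
   unchanged slightly later, when this image is zero. *)
Lemma push_not_alive X n D (x : 'I_n -> xelt X) i (h : R) :
  is_xbasis D x -> ~~ alive (x i) h -> push (x i) h = 0.
Proof.
move=> [_ free_x gen_x]; case xi: (x i) => [[b v]|//].
have [bh|hb] := leP b h; last first.
  by rewrite /push; case: {-}_ / idP => // bh; move: hb; rewrite ltNge bh.
move=> vNalive; have vh : (death v <= h%:E)%E.
  by move: vNalive; rewrite /alive bh /= -leNgt.
have [g hg alive_g] := alive_right x h.
have vg : tmap X (ltW hg) (push (x i) h) = 0.
  rewrite xi (push_Some _ bh) (tmap_comp _ _ (le_trans bh (ltW hg))) -push_Some.
  apply: push_after_death; first exact: le_lt_trans hg.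
  by apply: le_lt_trans vh _; rewrite lte_fin.
rewrite -xi; have [c cE] := gen_x h (push (x i) h).
rewrite cE big1// => j xjh.
suff -> : c j = 0 by rewrite scale0r.
(* The basis at [g] may contain elements born after [h]; they receive coefficient 0. *)
pose d j := if alive (x j) h then c j else 0.
have -> : c j = d j by rewrite /d xjh.
apply: (free_x g) (alive_g _ xjh).
apply: etrans vg; rewrite cE linear_sum big_mkcond [RHS]big_mkcond /=.
apply: eq_bigr => k _; rewrite /d; case: ifPn => [xkg|]; case: ifPn => // xkh.
- by rewrite linearZ /= tmap_push.
- by rewrite scale0r.
- by rewrite alive_g.
Qed.

(** Liveness depends on the bars alone, hence agrees for bases of different modules with the same
    vines. *)
Lemma alive_in_bar X n (D : 'I_n -> option (bar R)) (x : 'I_n -> xelt X) i h :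
  is_xbasis D x -> alive (x i) h = if D i is Some p then in_bar p h else false.
Proof.
case=> /(_ i) + _ _; case: (D i) => [p|]; case: (x i) => [[b v]|]//.
by case=> bp _ vp; rewrite /alive /in_bar -bp -vp.
Qed.

(** The matrix gives the image at the birth height [b], and naturality carries it to [h]. The sum
    may run over all [j] since [M j i] vanishes when [y j] is not alive at [b + e]. *)
Lemma emorph_push X Y (e : R) (a : emorph X Y e) m n (D : 'I_n -> option (bar R))
    (x : 'I_m -> xelt X) (y : 'I_n -> xelt Y) (M : 'M[K]_(n, m)) i h k
    (hk : k = h + e) :
  is_xbasis D y -> is_matrix_of a x y M -> alive (x i) h ->
  em a hk (push (x i) h) = \sum_j M j i *: push (y j) k.
Proof.
move=> y_basis /(_ i); case: (x i) => [[b v]|//] [av M0] /andP[bh _].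
have bk : b + e <= k by rewrite hk lerD2r.
rewrite (push_Some _ bh) -(em_tmap a bh bk erefl) av linear_sum big_mkcond /=.
apply: eq_bigr => j _; case: ifPn => [yj|/M0->]; last by rewrite scale0r.
by rewrite linearZ /= tmap_push.
Qed.

Lemma basis_matching_morph X Y n (D : 'I_n -> option (bar R))
    (x : 'I_n -> xelt X) (y : 'I_n -> xelt Y) :
  is_xbasis D x -> is_xbasis D y ->
  exists f : morph X Y, forall h i, morph_at f h (push (x i) h) = push (y i) h.
Proof.
move=> x_basis y_basis; have [_ free_x gen_x] := x_basis.
have aliveE h i : alive (x i) h = alive (y i) h.
  by rewrite (alive_in_bar _ _ x_basis) (alive_in_bar _ _ y_basis).
have f_ex h := linear_extension (fun i => push (y i) h) (free_x h) (gen_x h).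
pose f h := sval (cid (f_ex h)).
have fE h i : f h (push (x i) h) = push (y i) h.
  have [xi|xi] := boolP (alive (x i) h).
    by rewrite /f; case: cid => /= g; exact.
  rewrite (push_not_alive x_basis xi) linear0.
  by rewrite aliveE in xi; rewrite (push_not_alive y_basis xi).
have f_tmap g h (gh : g <= h) v : tmap Y gh (f g v) = f h (tmap X gh v).
  have fX : tmap Y gh \o f g =1 f h \o tmap X gh; last exact: fX v.
  apply: eq_linear_span (gen_x g) _ => i xi /=.
  by rewrite fE !tmap_push ?fE -?aliveE.
have le_add0 (h k : R) : k = h + 0 -> h <= k by move=> ->; rewrite addr0.
(* The target height [k] equals [h] only up to the proof [hk]; a transition map from [h] to [k]
   replaces a transport. *)
pose F h k (hk : k = h + 0) : {linear X h -> Y k} :=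
  tmap Y (le_add0 h k hk) \o f h.
have F_tmap g h k l (gh : g <= h) (kl : k <= l) (gk : k = g + 0)
    (hl : l = h + 0) v : tmap Y kl (F g k gk v) = F h l hl (tmap X gh v).
  rewrite /F /= -f_tmap.
  by rewrite !(tmap_comp _ _ (le_trans gh (le_add0 _ _ hl))).
by exists (EMorph F_tmap) => h i; rewrite /morph_at /= tmap_id fE.
Qed.

End ExtendedBasisTheory.

(** Exchanging the two modules and their bases gives the candidate inverse. *)
Lemma matching_vymorph (R : realType) (K : fieldType) (s0 s1 : R)
    (V W : vymod K s0 s1) (N : nat) (gam : 'I_N -> time s0 s1 -> option (bar R))
    (Ma Mb : forall s t : time s0 s1, tlt s t -> 'M[K]_N)
    (B : forall t, 'I_N -> xelt (V t)) (C : forall t, 'I_N -> xelt (W t)) :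
  (forall t, is_xbasis (gam^~ t) (B t)) ->
  (forall t, is_xbasis (gam^~ t) (C t)) ->
  (forall (s t : time s0 s1) (st : tlt s t),
     is_matrix_of (vy_a V st) (B s) (B t) (Ma s t st) /\
     is_matrix_of (vy_b V st) (B t) (B s) (Mb s t st)) ->
  (forall (s t : time s0 s1) (st : tlt s t),
     is_matrix_of (vy_a W st) (C s) (C t) (Ma s t st) /\
     is_matrix_of (vy_b W st) (C t) (C s) (Mb s t st)) ->
  exists F : vymorph V W,
    forall t h i, morph_at (F t) h (push (B t i) h) = push (C t i) h.
Proof.
move=> BP CP BM CM.
have f_ex t := basis_matching_morph (BP t) (CP t).
pose f t := sval (cid (f_ex t)).
have fE t h i : morph_at (f t) h (push (B t i) h) = push (C t i) h.
  by rewrite /f; case: cid.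
(* Arbitrary times and shift let this cover both families of interleaving maps. *)
have comm s t e (a : emorph (V s) (V t) e) (a' : emorph (W s) (W t) e) M :
    is_matrix_of a (B s) (B t) M -> is_matrix_of a' (C s) (C t) M ->
    forall h k (hk : k = h + e),
      morph_at (f t) k \o em a hk =1 em a' hk \o morph_at (f s) h.
  move=> aM a'M h k hk; have [_ _ gen_B] := BP s.
  apply: eq_linear_span (gen_B h) _ => i Bi /=.
  have Ci : alive (C s i) h.
    by rewrite (alive_in_bar _ _ (CP s)) -(alive_in_bar _ _ (BP s)).
  rewrite fE (emorph_push _ (BP t) aM)// (emorph_push _ (CP t) a'M)// linear_sum.
  by apply: eq_bigr => j _; rewrite linearZ /= fE.
unshelve eexists (VyMorph (vyf := f) _ _).
- move=> s t st; have [aM _] := BM s t st; have [a'M _] := CM s t st.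
  exact: comm aM a'M.
- move=> s t st; have [_ bM] := BM s t st; have [_ b'M] := CM s t st.
  exact: comm bM b'M.
- exact: fE.
Qed.

Theorem proposition5p2 (R : realType) (K : fieldType) (s0 s1 : R)
    (s01 : s0 <= s1) (V W : vymod K s0 s1) (N : nat)
    (gam : 'I_N -> time s0 s1 -> option (bar R))
    (gamP : is_vineyard gam)
    (VP : underlying_vineyard V gam) (WP : underlying_vineyard W gam)
    (Ma Mb : forall s t : time s0 s1, tlt s t -> 'M[K]_N)
    (VM : vine_matrix_repr V gam Ma Mb) (WM : vine_matrix_repr W gam Ma Mb) :
  vymod_iso V W.
Proof.
case: VM WM => [B BP BM] [C CP CM].
have [F FE] := matching_vymorph BP CP BM CM.
have [G GE] := matching_vymorph CP BP CM BM.
exists F, G => t h; have [_ _ gen_B] := BP t; have [_ _ gen_C] := CP t.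
split.
(* The composite fixes the images of the basis elements, which span. *)
- have GF : morph_at (G t) h \o morph_at (F t) h =1 idfun; last exact: GF.
  by apply: eq_linear_span (gen_B h) _ => i _ /=; rewrite FE GE.
- have FG : morph_at (F t) h \o morph_at (G t) h =1 idfun; last exact: FG.
  by apply: eq_linear_span (gen_C h) _ => i _ /=; rewrite GE FE.
Qed.
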